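(* Let $X=(X_t)_{t\ge0}$ be the process described in the context. If $R_\sigma$ is not degenerate, i.e. if it is not the case that $R_\sigma=\sigma^{-2}$ almost surely for every $\sigma\ge1$, then $X$ is not continuous (i.e. it is not true that the paths of $X$ are almost surely continuous).
   Context: $\varepsilon_a$ is the Dirac measure at $a$; $\phi(\mu,v,\cdot)$ is the density of the Gaussian distribution with mean $\mu$ and variance $v$. A family $(G_\sigma)_{\sigma\ge1}$ of probability measures on $[0,1]$ is a log-convolution semi-group if, for all $\sigma,\tau\ge1$, the product of two independent random variables with distributions $G_\sigma$ and $G_\tau$ has distribution $G_{\sigma\tau}$. It has Laplace exponent $\psi(\lambda)=\beta\lambda+\int_0^\infty(1-e^{-\lambda x})\nu(dx)$ if, for $R_\sigma$ distributed as $G_\sigma$, $L_\sigma(\lambda):=\mathbb{E}[(R_\sigma)^\lambda]=\sigma^{-\psi(\lambda)}$ for all $\sigma\ge1$, $\lambda>0$, where $\beta\ge0$ and $\nu$ is a measure on $[0,\infty)$ with $\nu(\{0\})=0$ and $\int_0^\infty(1\wedge x)\nu(dx)<\infty$. Standing setting: $(G_\sigma)_{\sigma\ge1}$ is a log-convolution semi-group with Laplace exponent $\psi$ satisfying $\psi(1/2)=1$ (equivalently $\mathbb{E}[\sqrt{R_\sigma}]=1/\sigma$), and $R_\sigma$ denotes a random variable with distribution $G_\sigma$. $X$ is the Markov martingale with $X_0=0$, adapted to a filtration $(\mathcal{F}_t)$ and Markov with respect to it, with transition probabilities: $P_{0,t}(x,dy)=\phi(x,t,y)\,dy$ for $t>0$,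 and for $0<s<t$, with $\sigma=\sqrt{t/s}$ and $\gamma(\sigma)=G_\sigma(\{1\})$, $$P_{s,t}(x,dy)=\gamma(\sigma)\,\varepsilon_{\sigma x}(dy)+\left(\int_{[0,1)}\phi\big(\sigma\sqrt r\,x,\;t(1-r),\;y\big)\,G_\sigma(dr)\right)dy.$$ Each $X_t$ is Gaussian with mean $0$ and variance $t$. *)

(* Defs.v *)
From HB Require Import structures.
From mathcomp Require Import all_boot all_order all_algebra.
From mathcomp Require Import all_classical all_reals all_analysis.
From mathcomp Require Import measurable_realfun.
Import Order.TTheory GRing.Theory Num.Theory.
Import numFieldNormedType.Exports.

Set Implicit Arguments.
Unset Strict Implicit.
Unset Printing Implicit Defensive.

Local Open Scope classical_set_scope.
Local Open Scope ring_scope.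

Definition independent_rv (d : measure_display) (T : measurableType d)
    (R : realType) (P : probability T R) (U V : {RV P >-> R}) : Prop :=
  forall A B : set R, measurable A -> measurable B ->
    P (U @^-1` A `&` V @^-1` B) = (P (U @^-1` A) * P (V @^-1` B))%E.

Definition has_law (d : measure_display) (T : measurableType d)
    (R : realType) (P : probability T R) (U : T -> R) (mu : probability R R)
    : Prop :=
  forall B : set R, measurable B -> P (U @^-1` B) = mu B.

(* A probability measure on [0,1] is a probability measure on the line that
   gives mass 1 to [0,1]; only the indices sigma >= 1 are constrained. *)
Definition log_convolution_semigroup (R : realType) (G : R -> probability R R)
    : Prop :=
  (forall sigma : R, 1 <= sigma -> G sigma `[0, 1]%classic = 1%E) /\
  (forall sigma tau : R, 1 <= sigma -> 1 <= tau ->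
     forall (d : measure_display) (T : measurableType d) (P : probability T R)
            (U V : {RV P >-> R}),
       independent_rv U V -> has_law P U (G sigma) -> has_law P V (G tau) ->
       has_law P (fun w => U w * V w) (G (sigma * tau))).

(* nu is a measure on [0,+oo[, seen as a measure on the line that vanishes on
   the negative half-line. *)
Definition has_Laplace_exponent (R : realType) (G : R -> probability R R)
    (psi : R -> R) : Prop :=
  exists (beta : R) (nu : {measure set R -> \bar R}),
    [/\ 0 <= beta,
        nu `]-oo, 0[%classic = 0%E /\ nu [set 0%R] = 0%E,
        (\int[nu]_(x in `[0%R, +oo[) (Num.min 1 x)%:E < +oo)%E,
        forall l : R, 0 < l ->
          (psi l)%:E = ((beta * l)%:E +
            \int[nu]_(x in `[0%R, +oo[) (1 - expR (- (l * x)))%:E)%E &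
        forall sigma l : R, 1 <= sigma -> 0 < l ->
          ('E_(G sigma)[fun r : R => (r `^ l)%R] = (sigma `^ (- psi l))%:E)%E].

(* normal_pdf is parameterized by the standard deviation, phi by the variance *)
Definition phi (R : realType) (m v y : R) : R := normal_pdf m (Num.sqrt v) y.

Definition transition (R : realType) (G : R -> probability R R) (s t x : R)
    (B : set R) : \bar R :=
  if s == 0 then (\int[lebesgue_measure]_(y in B) (phi x t y)%:E)%E
  else let sigma := Num.sqrt (t / s) in
    (G sigma [set 1%R] * \d_(sigma * x)%R B +
     \int[lebesgue_measure]_(y in B) \int[G sigma]_(r in `[0%R, 1%R[)
       (phi (sigma * Num.sqrt r * x) (t * (1 - r)) y)%:E)%E.

(* Time runs over the nonnegative elements of R; the values of F and of the
   process at negative indices are unconstrained. *)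
Definition filtration (d : measure_display) (T : measurableType d)
    (R : realType) (F : R -> set (set T)) : Prop :=
  (forall t : R, 0 <= t -> sigma_algebra setT (F t) /\ F t `<=` measurable) /\
  (forall s t : R, 0 <= s -> s <= t -> F s `<=` F t).

Definition adapted (d : measure_display) (T : measurableType d)
    (R : realType) (F : R -> set (set T)) (X : R -> T -> R) : Prop :=
  forall t : R, 0 <= t ->
  forall B : set R, measurable B -> F t (X t @^-1` B).

(* Y is a version of the conditional expectation of Z given the
   sub-sigma-algebra H. *)
Definition is_condexp (d : measure_display) (T : measurableType d)
    (R : realType) (P : probability T R) (H : set (set T))
    (Z Y : T -> \bar R) : Prop :=
  [/\ P.-integrable setT Z,
      P.-integrable setT Y,
      forall C : set (\bar R), measurable C -> H (Y @^-1` C) &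
      forall A : set T, H A ->
        (\int[P]_(w in A) Y w = \int[P]_(w in A) Z w)%E].

Definition martingale (d : measure_display) (T : measurableType d)
    (R : realType) (P : probability T R) (F : R -> set (set T))
    (X : R -> T -> R) : Prop :=
  forall s t : R, 0 <= s -> s <= t ->
    is_condexp P (F s) (fun w => (X t w)%:E) (fun w => (X s w)%:E).

Definition markov_with (d : measure_display) (T : measurableType d)
    (R : realType) (P : probability T R) (F : R -> set (set T))
    (p : R -> R -> R -> set R -> \bar R) (X : R -> T -> R) : Prop :=
  forall s t : R, 0 <= s -> s < t ->
  forall B : set R, measurable B ->
    is_condexp P (F s) (fun w => (\1_(X t @^-1` B) w)%:E)
                       (fun w => p s t (X s w) B).

Definition continuous_process (d : measure_display) (T : measurableType d)
    (R : realType) (P : probability T R) (X : R -> T -> R) : Prop :=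
  {ae P, forall w, {within `[0, +oo[, continuous (fun t : R => X t w)}}.

Definition degenerate (R : realType) (G : R -> probability R R) : Prop :=
  forall sigma : R, 1 <= sigma -> {ae G sigma, forall r : R, r = sigma ^- 2}.

(* Main.v *)
(* Put p = psi 1. Cauchy-Schwarz gives p <= 2, and p = 2 makes sqrt R_sigma
   almost surely constant; so p < 2 in the nondegenerate case. Then, for
   sigma = e^l, E(1 - sqrt R_sigma)^2 = 1 - 2 e^-l + e^(-p l) is at least a
   multiple of l while E(1 - sqrt R_sigma) <= l, whence
   P(R_sigma < q^2) >= c l for some q < 1 and c > 0 and all small l. On that
   event the Gaussian component of the transition has variance bounded away from
   0, so it leaves any given short interval with probability at least 1/2,
   whatever its mean. Along the times exp(2k/n), 0 <= k <= n, each increment is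
   therefore larger than a fixed eps with conditional probability at least
   c/(2n), and all of them are at most eps with probability at most
   (1 - c/(2n))^n <= exp(-c/2) < 1. For continuous paths this probability would
   tend to 1, by uniform continuity. *)
Require Import Defs.
From HB Require Import structures.
From mathcomp Require Import all_boot all_order all_algebra.
From mathcomp Require Import all_classical all_reals all_analysis.
From mathcomp Require Import measurable_realfun.
From mathcomp Require Import ring lra.
Import Order.TTheory GRing.Theory Num.Theory.
Import numFieldNormedType.Exports.

Local Open Scope classical_set_scope.
Local Open Scope ring_scope.

(** * Moments of [r] and [sqrt r] under a probability measure on the unit interval *)

Section unit_interval_moments.
Context {R : realType} (mu : probability R R).
Hypothesis mu01 : mu `[0, 1]%classic = 1%E.

Lemma compl_unit_itv0 : mu (~` `[0, 1]%classic) = 0%E.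
Proof. by rewrite probability_setC// mu01 subee. Qed.

Lemma expectation_unit_itv (f : R -> R) : measurable_fun setT f ->
  (forall r, 0 <= f r) ->
  ('E_mu[f] = \int[mu]_(r in `[0%R, 1%R]) (f r)%:E)%E.
Proof.
move=> mf f0; rewrite unlock.
rewrite (@ge0_negligible_integral _ _ _ mu setT (~` `[0%R, 1%R]%classic))//.
- by rewrite setTD setCK.
- by apply: measurableC.
- exact/measurable_EFinP.
- by move=> x _; rewrite lee_fin.
- exact: compl_unit_itv0.
Qed.

Context (a b : R).
Hypothesis half_moment : ('E_mu[fun r : R => (r `^ 2^-1)%R] = a%:E)%E.
Hypothesis first_moment : ('E_mu[fun r : R => (r `^ 1)%R] = b%:E)%E.

Let m_sqrt : measurable_fun (`[0%R, 1%R]%classic : set R)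
  (fun r : R => (Num.sqrt r)%:E).
Proof.
apply/measurable_EFinP; apply: measurable_funTS.
by apply: continuous_measurable_fun; exact: sqrt_continuous.
Qed.

Let m_id : measurable_fun (`[0%R, 1%R]%classic : set R) (fun r : R => r%:E).
Proof. exact/measurable_EFinP. Qed.

Let sqrt_ge0E (c r : R) : 0 <= c -> (0 <= (c * Num.sqrt r)%:E)%E.
Proof. by move=> c0; rewrite lee_fin mulr_ge0. Qed.

Lemma integral_sqrt (c : R) : 0 <= c ->
  (\int[mu]_(r in `[0%R, 1%R]) (c * Num.sqrt r)%:E = (c * a)%:E)%E.
Proof.
move=> c0; under eq_integral do rewrite EFinM.
rewrite ge0_integralZl// ?lee_fin//.
rewrite EFinM -half_moment expectation_unit_itv;
  [ |exact: measurable_powR|by move=> r; exact: powR_ge0].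
congr (_ * _)%E; apply: eq_integral => r; rewrite inE/= in_itv/= => /andP[r0 _].
by rewrite powR12_sqrt.
Qed.

Lemma integral_id : (\int[mu]_(r in `[0%R, 1%R]) r%:E = b%:E)%E.
Proof.
rewrite -first_moment expectation_unit_itv;
  [ |exact: measurable_powR|by move=> r; exact: powR_ge0].
apply: eq_integral => r; rewrite inE/= in_itv/= => /andP[r0 _].
by rewrite powRr1.
Qed.

Lemma integral_cst_unit_itv (c : R) :
  (\int[mu]_(r in `[0%R, 1%R]) c%:E = c%:E)%E.
Proof. by rewrite integral_cst//= mu01 mule1. Qed.

Let m_Zsqrt (c : R) : measurable_fun (`[0%R, 1%R]%classic : set R)
  (fun r : R => (c * Num.sqrt r)%:E).
Proof.
by apply/measurable_EFinP/measurable_funM => //; exact/measurable_EFinP.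
Qed.

(* The integral of [(1 - sqrt r)^2 <= 1_(sqrt r < q) + (1 - q)(1 - sqrt r)],
   rearranged so that both sides are sums of nonnegative terms. *)
Lemma mass_near0_ge (q : R) : 0 <= q -> q <= 1 ->
  1 + b + (1 - q) * a <= fine (mu `[0, q ^+ 2[%classic) + (1 - q) + 2 * a.
Proof.
move=> q0 q1.
have q1' : 0 <= 1 - q by rewrite subr_ge0.
have mS : measurable `[0, q ^+ 2[%classic by [].
have : (\int[mu]_(r in `[0%R, 1%R]) (1%:E + r%:E + ((1 - q) * Num.sqrt r)%:E) <=
    \int[mu]_(r in `[0%R, 1%R])
      ((\1_(`[0, q ^+ 2[%classic) r)%:E + (1 - q)%:E + (2 * Num.sqrt r)%:E))%E.
  apply: ge0_le_integral => //.
  - move=> r; rewrite /= in_itv/= => /andP[r0 _].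
    by rewrite !adde_ge0 ?lee_fin ?mulr_ge0.
  - by apply: emeasurable_funD => //; apply: emeasurable_funD.
  - apply: emeasurable_funD => //; apply: emeasurable_funD => //.
    exact/measurable_EFinP/measurable_indic.
  move=> r; rewrite /= in_itv/= => /andP[r0 r1].
  have sr1 : Num.sqrt r <= 1 by rewrite -sqrtr1 ler_sqrt.
  have sr0 := sqrtr_ge0 r.
  have rE : r = Num.sqrt r ^+ 2 by rewrite sqr_sqrtr.
  rewrite -!EFinD lee_fin indicE.
  have [rq|rq] := ltP r (q ^+ 2).
    by rewrite mem_set/= ?in_itv/= ?r0//; nra.
  rewrite memNset/= ?in_itv/= ?r0/= ?ltNge ?rq//.
  have : q <= Num.sqrt r by rewrite -(ger0_norm q0) -sqrtr_sqr ler_sqrt.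
  nra.
rewrite !ge0_integralD//=.
- rewrite !integral_sqrt// !integral_cst_unit_itv integral_id.
  rewrite integral_indic// setIidl; last first.
    apply: subset_itvScc; rewrite ?bnd_simp//.
    by rewrite expr_le1.
  by rewrite -[X in (_ <= X + _ + _)%E -> _]fineK ?fin_num_measure//
    -!EFinD lee_fin.
- exact/measurable_EFinP/measurable_indic.
- by move=> r _; rewrite ?(adde_ge0,lee_fin)// indicE.
- by apply: emeasurable_funD => //; exact/measurable_EFinP/measurable_indic.
- by move=> r; rewrite in_itv/= => /andP[r0 _]; rewrite lee_fin.
- by move=> r; rewrite in_itv/= => /andP[r0 _]; rewrite adde_ge0 ?lee_fin.
- exact: emeasurable_funD.
- by move=> r _; exact: sqrt_ge0E.
Qed.

(** Expansion of the square, with the cross term kept on the left so that only nonnegative functions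
    are integrated. For [c = a] the integral is the variance of [sqrt r]. *)
Lemma integral_sqrt_dev (c : R) : 0 <= c ->
  (\int[mu]_(r in `[0%R, 1%R]) ((Num.sqrt r - c) ^+ 2)%:E + (2 * c * a)%:E =
   (b + c ^+ 2)%:E)%E.
Proof.
move=> c0.
rewrite -integral_sqrt ?mulr_ge0// -ge0_integralD//.
- transitivity (\int[mu]_(r in `[0%R, 1%R]) (r%:E + (c ^+ 2)%:E))%E.
    apply: eq_integral => r; rewrite inE/= in_itv/= => /andP[r0 _].
    rewrite -!EFinD; congr (_%:E).
    by rewrite -[in RHS](sqr_sqrtr r0); ring.
  rewrite ge0_integralD//; first by rewrite integral_id integral_cst_unit_itv.
  + by move=> r; rewrite /= in_itv/= => /andP[r0 _]; rewrite lee_fin.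
  + by move=> r _; rewrite lee_fin sqr_ge0.
- by move=> r _; rewrite lee_fin sqr_ge0.
- apply/measurable_EFinP/measurable_funX/measurable_funB => //.
  exact/measurable_EFinP.
- by move=> r _; rewrite lee_fin mulr_ge0// mulr_ge0.
Qed.

(** Cauchy-Schwarz, read as nonnegativity of the variance of [sqrt r]. *)
Lemma sqr_half_moment_le : 0 <= a -> a ^+ 2 <= b.
Proof.
move=> a0; have := integral_sqrt_dev a a0.
have : (0 <= \int[mu]_(r in `[0%R, 1%R]) ((Num.sqrt r - a) ^+ 2)%:E)%E.
  by apply: integral_ge0 => r _; rewrite lee_fin sqr_ge0.
case: (\int[mu]_(r in _) _)%E => [x| |]//=.
by rewrite lee_fin => x0 [] h; nra.
Qed.

(** The equality case: zero variance makes [sqrt r] almost surely equal to its mean [a]. *)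
Lemma ae_eq_sqr_half_moment : 0 <= a -> b = a ^+ 2 ->
  {ae mu, forall r, r = a ^+ 2}.
Proof.
move=> a0 ba.
have m_dev : measurable_fun (`[0%R, 1%R]%classic : set R)
    (fun r : R => ((Num.sqrt r - a) ^+ 2)%:E).
  apply/measurable_EFinP/measurable_funX/measurable_funB => //.
  exact/measurable_EFinP.
have I0 : (\int[mu]_(r in `[0%R, 1%R]) `|((Num.sqrt r - a) ^+ 2)%:E| = 0)%E.
  transitivity (\int[mu]_(r in `[0%R, 1%R]) ((Num.sqrt r - a) ^+ 2)%:E)%E.
    by apply: eq_integral => r _; rewrite gee0_abs// lee_fin sqr_ge0.
  have := integral_sqrt_dev a a0; rewrite ba.
  case: (\int[mu]_(r in _) _)%E => [x| |]//= [] h.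
  by congr (_%:E); nra.
have /ae_eq_integral_abs := I0.
move=> /(_ (measurable_itv _) m_dev) ae0.
have aeI : {ae mu, forall r, `[0%R, 1%R]%classic r}.
  exists (~` `[0%R, 1%R]%classic); split => //; first exact: measurableC.
  exact: compl_unit_itv0.
apply: filterS2 ae0 aeI => r h rI; have := h rI.
move: rI; rewrite /= in_itv/= => /andP[r0 _] [] /eqP.
by rewrite sqrf_eq0 subr_eq0 => /eqP <-; rewrite sqr_sqrtr.
Qed.

End unit_interval_moments.

(** * Mass that [G sigma] puts away from 1 when [sigma] is close to 1 *)

Section jump_mass.
Context {R : realType} (G : R -> probability R R) (psi : R -> R).
Hypothesis hG : log_convolution_semigroup G.
Hypothesis hpsi : has_Laplace_exponent G psi.
Hypothesis hpsi_half : psi (2^-1) = 1.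

Lemma half_momentE (sigma : R) : 1 <= sigma ->
  ('E_(G sigma)[fun r : R => (r `^ 2^-1)%R] = (sigma^-1)%:E)%E.
Proof.
move=> s1; case: hpsi => beta [nu [_ _ _ _ ->//]].
by rewrite hpsi_half powR_inv1// (le_trans _ s1).
Qed.

Lemma first_momentE (sigma : R) : 1 <= sigma ->
  ('E_(G sigma)[fun r : R => (r `^ 1)%R] = (sigma `^ (- psi 1))%:E)%E.
Proof. by move=> s1; case: hpsi => beta [nu [_ _ _ _ ->]]. Qed.

(** At [sigma = expR 1] Cauchy-Schwarz reads [expR (- 2) <= expR (- psi 1)]. If [psi 1 = 2],
    equality holds for every [sigma], which is the degenerate case. *)
Lemma psi1_lt2 : ~ degenerate G -> psi 1 < 2.
Proof.
move=> nd; case: hG => G01 _.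
have psi1_le2 : psi 1 <= 2.
  have e1 : 1 <= expR 1 :> R by rewrite -expR0 ler_expR.
  have := sqr_half_moment_le _ (G01 _ e1) _ _ (half_momentE _ e1)
    (first_momentE _ e1).
  rewrite invr_ge0 expR_ge0 => /(_ isT).
  rewrite /powR gt_eqF ?expR_gt0// expRK mulr1 -expRN expr2 -expRD ler_expR.
  lra.
rewrite lt_neqAle psi1_le2 andbT; apply/eqP => p2; apply: nd => sigma s1.
have := ae_eq_sqr_half_moment _ (G01 _ s1) _ _ (half_momentE _ s1)
  (first_momentE _ s1).
rewrite p2 exprVn; apply; first by rewrite invr_ge0 (le_trans _ s1).
by rewrite powRN -powR_mulrn// (le_trans _ s1).
Qed.

Lemma jump_mass_ge : ~ degenerate G -> exists q c l0 : R,
  [/\ 0 <= q, q < 1, 0 < c, 0 < l0 & forall l, 0 < l -> l <= l0 ->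
    c * l <= fine (G (expR l) `[0, q ^+ 2[%classic)].
Proof.
move=> /psi1_lt2 p2.
(* With [a = expR (- l)], the mass is at least [1 - 2 * a + b - e * (1 - a)], hence at least
   [(2 - psi 1) * l - 2 * l ^+ 2 - e * l]. Of the [4 * e * l] available, the quadratic term takes
   two parts (as [l <= e]) and the last term one; [e * l] remains. The bound [e <= 1] gives
   [0 <= q]. *)
set e := Num.min 1 ((2 - psi 1) / 4).
have e0 : 0 < e by rewrite lt_min ltr01/= divr_gt0// subr_gt0.
have e1 : e <= 1 by rewrite ge_min lexx.
have ep : e <= (2 - psi 1) / 4 by rewrite ge_min lexx orbT.
exists (1 - e), e, e; split; [lra|lra|by []|by []|] => l l0 le.
case: hG => G01 _.
have l1 : 1 <= expR l by rewrite -expR0 ler_expR ltW.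
have := mass_near0_ge _ (G01 _ l1) _ _ (half_momentE _ l1)
  (first_momentE _ l1) (1 - e).
rewrite subr_ge0 e1 gerBl ltW// => /(_ isT isT).
rewrite opprB addrCA subrr addr0.
have -> : expR l `^ (- psi 1) = expR (- (psi 1 * l)).
  by rewrite /powR gt_eqF ?expR_gt0// expRK mulNr.
have := expR_ge1Dx (- (psi 1 * l)).
have := expR_ge1Dx (- l).
have : (expR l)^-1 * (1 + l) <= 1.
  by rewrite mulrC ler_pdivrMr ?expR_gt0// mul1r expR_ge1Dx.
rewrite -expRN.
set a := expR (- l); set b := expR _; set m := fine _ => h1 h2 h3 h4.
(* Here [a * (1 + l) <= 1], while [(1 - l + l ^+ 2) * (1 + l) = 1 + l ^+ 3]. *)
have h5 : a <= 1 - l + l ^+ 2.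
  have : a * (1 + l) <= (1 - l + l ^+ 2) * (1 + l) by nra.
  by rewrite ler_pM2r// addr_gt0.
nra.
Qed.

End jump_mass.

(** * Escape of the transition kernel from short intervals *)

Section transition_lower_bound.
Context {R : realType}.
Local Notation leb := (@lebesgue_measure R).

Lemma le_normal_peak (s0 s : R) : 0 < s0 -> s0 <= s ->
  normal_peak s <= normal_peak s0.
Proof.
move=> s00 s0s; have s_gt0 := lt_le_trans s00 s0s.
have pos (x : R) : 0 < x -> 0 < x ^+ 2 * pi *+ 2.
  by move=> x0; rewrite pmulrn_lgt0// mulr_gt0 ?pi_gt0 ?exprn_gt0.
rewrite /normal_peak lef_pV2 ?posrE ?sqrtr_gt0 ?pos//.
rewrite ler_sqrt; last exact/ltW/pos.
rewrite ler_pMn2r//.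
by rewrite ler_pM2r ?pi_gt0// ler_sqr ?nnegrE//; exact: ltW.
Qed.

(** The density never exceeds its peak, which decreases in [s]; so the interval has mass at most one
    half, whatever the mean [m]. *)
Lemma normal_compl_itv_ge (m s s0 u w : R) : 0 < s0 -> s0 <= s -> u <= w ->
  normal_peak s0 * (w - u) <= 2^-1 ->
  ((2^-1)%:E <= \int[leb]_(y in ~` `[u, w]) (normal_pdf m s y)%:E)%E.
Proof.
move=> s00 s0s uw small; have s_gt0 := lt_le_trans s00 s0s.
have sn0 : s != 0 by rewrite gt_eqF.
have itv_le : (normal_prob m s `[u, w]%classic <= (2^-1)%:E)%E.
  rewrite /normal_prob.
  apply: (@le_trans _ _ (\int[leb]_(y in `[u, w]) (normal_peak s0)%:E)%E).
    apply: ge0_le_integral => //.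
    - by move=> y _; rewrite lee_fin normal_pdf_ge0.
    - apply/measurable_funTS/measurable_EFinP; exact: measurable_normal_pdf.
    - move=> y _; rewrite lee_fin (le_trans (normal_pdf_ub _ _ _))//.
      exact: le_normal_peak.
  rewrite integral_cst//= lebesgue_measure_itv/= lte_fin.
  by case: ltP => _; rewrite ?mule0 -?EFinB -?EFinM lee_fin.
have := probability_setC (normal_prob m s) (measurable_itv `[u, w]).
rewrite -[X in X = _ -> _]/(\int[leb]_(y in ~` `[u, w])
  (normal_pdf m s y)%:E)%E.
move=> ->.
rewrite -[X in (_ <= _ - X)%E]fineK ?fin_num_measure//.
move: itv_le; rewrite -[X in (X <= _)%E]fineK ?fin_num_measure// !lee_fin; lra.
Qed.

Variables (sigma t x : R).

(* Inverses are written as powers because the library has the measurability of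
   [powR] but not that of the inverse. *)
Let density (z : R * R) : R :=
  let v := Num.sqrt (t * (1 - z.2)) ^+ 2 in
  Num.sqrt (v * pi *+ 2) `^ (-1) *
  expR (- (z.1 - sigma * Num.sqrt z.2 * x) ^+ 2 * (v *+ 2) `^ (-1)).

Let m_sqrt (f : R * R -> R) : measurable_fun setT f ->
  measurable_fun setT (fun z => Num.sqrt (f z)).
Proof.
move=> mf; apply: (measurableT_comp _ mf); apply: continuous_measurable_fun.
exact: sqrt_continuous.
Qed.

Let m_inv (f : R * R -> R) : measurable_fun setT f ->
  measurable_fun setT (fun z => f z `^ (-1)).
Proof. move=> mf; exact: (measurableT_comp (measurable_powR (-1)) mf). Qed.

Let measurable_density : measurable_fun setT density.
Proof.
have mv : measurable_fun setT
    (fun z : R * R => Num.sqrt (t * (1 - z.2)) ^+ 2).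
  apply: measurable_funX; apply: m_sqrt; apply: measurable_funM => //.
  exact: measurable_funB.
apply: measurable_funM.
  apply: m_inv; apply: m_sqrt; under eq_fun do rewrite -mulr_natr.
  by apply: measurable_funM => //; exact: measurable_funM.
apply: measurableT_comp => //; apply: measurable_funM.
  apply: measurableT_comp => //; apply: measurable_funX.
  apply: measurable_funB => //; apply: measurable_funM => //.
  by apply: measurable_funM => //; exact: m_sqrt.
apply: m_inv; under eq_fun do rewrite -mulr_natr.
exact: measurable_funM.
Qed.

Let density_ge0 z : 0 <= density z.
Proof. by rewrite mulr_ge0 ?powR_ge0 ?expR_ge0. Qed.

Let densityE (r y : R) : 0 < t -> r < 1 ->
  phi (sigma * Num.sqrt r * x) (t * (1 - r)) y = density (y, r).
Proof.
move=> t0 r1.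
have s0 : Num.sqrt (t * (1 - r)) != 0.
  by rewrite gt_eqF// sqrtr_gt0 mulr_gt0// subr_gt0.
rewrite /phi normal_pdfE// /density/= !powR_inv1//.
Qed.

(** By Tonelli the mixture is integrated in [y] first; each [r < q] then contributes at least [c],
    and the remaining [r] are dropped. *)
Lemma mixture_ge (mu : probability R R) (q c : R) (B : set R) :
  0 < t -> q <= 1 -> 0 <= c -> measurable B ->
  (forall r, 0 <= r -> r < q ->
    (c%:E <= \int[leb]_(y in B)
      (phi (sigma * Num.sqrt r * x) (t * (1 - r)) y)%:E)%E) ->
  (c%:E * mu `[0%R, q[%classic <=
   \int[leb]_(y in B) \int[mu]_(r in `[0%R, 1%R[)
     (phi (sigma * Num.sqrt r * x) (t * (1 - r)) y)%:E)%E.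
Proof.
move=> t0 q1 c0 mB hB.
pose J : set R := `[0, 1[%classic.
(* Both domains become indicators, so that [f] is jointly measurable on the plane. [J] excludes
   [r = 1], where the variance vanishes and [densityE] does not apply. *)
pose f (z : R * R) : \bar R := (\1_B z.1 * (\1_J z.2 * density z))%:E.
have mi (C : set R) (g : R * R -> R) : measurable C ->
    measurable_fun setT g -> measurable_fun setT (fun z => \1_C (g z) : R).
  move=> mC mg; exact: (measurableT_comp (measurable_indic mC) mg).
have mf : measurable_fun setT f.
  apply/measurable_EFinP/measurable_funM.
    by apply: (mi B fst) => //; exact: measurable_fst.
  apply: measurable_funM => //.
  by apply: (mi J snd); [exact: measurable_itv|exact: measurable_snd].
have f0 z : (0 <= f z)%E.
  by rewrite lee_fin mulr_ge0 ?mulr_ge0 ?indicE.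
have -> : (\int[leb]_(y in B) \int[mu]_(r in `[0%R, 1%R[)
     (phi (sigma * Num.sqrt r * x) (t * (1 - r)) y)%:E =
   \int[leb]_y \int[mu]_r f (y, r))%E.
  rewrite [LHS]integral_mkcond; apply: eq_integral => y _; rewrite patchE.
  case: ifPn => yB; last first.
    rewrite integral0_eq// => r _; rewrite /f/= indicE (negbTE yB).
    by rewrite mul0r.
  rewrite integral_mkcond; apply: eq_integral => r _; rewrite patchE /f/=.
  rewrite !indicE yB mul1r; case: ifPn => rJ; rewrite ?mul0r// mul1r densityE//.
  by move: rJ; rewrite inE/= in_itv/= => /andP[].
rewrite fubini_tonelli//.
apply: (@le_trans _ _ (\int[mu]_(r in `[0%R, q[) \int[leb]_y f (y, r))%E).
  rewrite -integral_cst//; apply: ge0_le_integral => //.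
  - apply: measurable_funTS; exact: measurable_fun_fubini_tonelli_G.
  move=> r /=; rewrite in_itv/= => /andP[r0 rq].
  have r1 : r < 1 by exact: lt_le_trans q1.
  apply: (le_trans (hB _ r0 rq)).
  rewrite [leLHS]integral_mkcond le_eqVlt; apply/orP; left; apply/eqP.
  apply: eq_integral => y _; rewrite patchE /f/= !indicE densityE//.
  have -> : r \in J by rewrite inE/J/= in_itv/= r0.
  by case: (y \in B); rewrite ?mul0r// !mul1r.
apply: ge0_subset_integral => //.
- exact: measurable_fun_fubini_tonelli_G.
- by move=> r _; exact: integral_ge0.
Qed.

End transition_lower_bound.

(** The atom is discarded. For [r < q] and [t >= 1] the variance [t * (1 - r)] is at least [1 - q],
    so every such Gaussian component escapes with probability at least one half. *)
Lemma transition_compl_itv_ge {R : realType} (G : R -> probability R R)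
    (q s t x u w : R) :
  0 <= q -> q < 1 -> 0 < s -> 1 <= t -> u <= w ->
  normal_peak (Num.sqrt (1 - q)) * (w - u) <= 2^-1 ->
  ((2^-1)%:E * G (Num.sqrt (t / s)) `[0%R, q[%classic <=
   transition G s t x (~` `[u, w]%classic))%E.
Proof.
move=> q0 q1 s0 t1 uw small; have t0 : 0 < t by rewrite (lt_le_trans _ t1).
rewrite /transition gt_eqF//.
apply: (le_trans _ (leeDr _ _)); last by rewrite mule_ge0.
apply: mixture_ge => //; first exact: ltW.
  exact: measurableC.
move=> r r0 rq; apply: (normal_compl_itv_ge _ _ (Num.sqrt (1 - q))) => //.
  by rewrite sqrtr_gt0 subr_gt0.
rewrite ler_sqrt; nra.
Qed.

(** * Auxiliary facts on events and countable partitions *)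

Lemma sigma_algebra_setI {T : Type} (F : set (set T)) (A B : set T) :
  sigma_algebra setT F -> F A -> F B -> F (A `&` B).
Proof. by move=> /(sigma_algebraP (fun X _ => @subsetT _ X))[_ _ _]; apply. Qed.

Lemma probability_setI_le {d : measure_display} {T : measurableType d}
    {R : realType} (P : probability T R) (A B : set T) (c : R) :
  measurable A -> measurable B -> (c%:E * P A <= P (~` B `&` A))%E ->
  (P (A `&` B) <= (1 - c)%:E * P A)%E.
Proof.
move=> mA mB.
have PA : P A = (P (~` B `&` A) + P (A `&` B))%E.
  by rewrite [LHS](measureDI P mA mB) setDE (setIC A (~` B)).
have fin C : measurable C -> P C = (fine (P C))%:E.
  by move=> mC; rewrite fineK// fin_num_measure.
have mBA : measurable (~` B `&` A).
  by apply: measurableI => //; exact: measurableC.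
have mAB : measurable (A `&` B) by exact: measurableI.
move: PA; rewrite (fin _ mA) (fin _ mBA) (fin _ mAB) => -[->].
rewrite -!EFinM !lee_fin; lra.
Qed.

(** Countable additivity over the fibers of [N]. *)
Lemma measure_le_fibers {d : measure_display} {T : measurableType d}
    {R : realType} (mu : {measure set T -> \bar R}) (A B : set T)
    (N : T -> nat) (c : R) : 0 <= c ->
  (forall n, measurable (A `&` N @^-1` [set n])) ->
  (forall n, measurable (A `&` B `&` N @^-1` [set n])) ->
  (forall n, (mu (A `&` B `&` N @^-1` [set n]) <=
              c%:E * mu (A `&` N @^-1` [set n]))%E) ->
  (mu (A `&` B) <= c%:E * mu A)%E.
Proof.
move=> c0 mA mAB fibers.
have cover (C : set T) : C = \bigcup_n (C `&` N @^-1` [set n]).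
  by rewrite -setI_bigcupr; apply/seteqP; split=> [w Cw|w []//]; split => //;
     exists (N w).
have disj (C : set T) : trivIset setT (fun n => C `&` N @^-1` [set n]).
  by move=> i j _ _ [w [[_ <-] [_ <-]]].
rewrite [in leLHS](cover (A `&` B)) [in leRHS](cover A) !measure_bigcup//.
rewrite -nneseriesZl//; apply: lee_nneseries => // n _.
Qed.

(** * One step of a Markov process, with the starting point discretized into cells *)

Section one_step.
Context {R : realType} {d : measure_display} {T : measurableType d}.
Variables (P : probability T R) (F : R -> set (set T)) (X : R -> T -> R).
Variable p : R -> R -> R -> set R -> \bar R.
Hypotheses (hF : filtration F) (hX : adapted F X) (hp : markov_with P F p X).

(** The cell of index [z] and width [eps], enlarged by [eps] on either side; its length is
    [3 * eps]. *)
Definition cell_window (eps : R) (z : int) : set R :=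
  `[(z%:~R - 1) * eps, (z%:~R + 2) * eps]%classic.

(* A version of [`|X t - X s| <= eps] in which the window allowed for [X t]
   depends on [X s] only through countably many values, so that the Markov
   property, stated for fixed sets, applies. *)
Definition small_step (eps s t : R) : set T :=
  [set w | cell_window eps (Num.floor (X s w / eps)) (X t w)].

Lemma small_stepP (eps s t : R) w : 0 < eps -> `|X t w - X s w| <= eps ->
  small_step eps s t w.
Proof.
move=> e0; rewrite ler_norml => /andP[h1 h2].
have /andP[] := floor_itv (X s w / eps).
rewrite /small_step /cell_window/= in_itv/= rmorphD/=.
rewrite ler_pdivlMr// ltr_pdivrMr// => h3 h4.
by apply/andP; split; nra.
Qed.

Let cell (eps s : R) (z : int) : set T :=
  X s @^-1` `[z%:~R * eps, (z%:~R + 1) * eps[%classic.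

Let cellE (eps s : R) (z : int) : 0 < eps ->
  cell eps s z = [set w | Num.floor (X s w / eps) = z].
Proof.
move=> e0; apply/seteqP; split=> w; rewrite /cell/= in_itv/=.
  move=> /andP[h1 h2]; apply: floor_def.
  by rewrite rmorphD/= ler_pdivlMr// ltr_pdivrMr// h1.
move=> <-; have := floor_itv (X s w / eps).
by rewrite rmorphD/= ler_pdivlMr// ltr_pdivrMr.
Qed.

Let F_cell (eps s : R) (z : int) : 0 <= s -> F s (cell eps s z).
Proof. by move=> s0; exact: hX. Qed.

(** Integer cell indices are coded by naturals through [pickle]; a natural that codes no integer has
    an empty fiber. *)
Let fiberE (eps s : R) n : 0 < eps ->
  (fun w => pickle (Num.floor (X s w / eps))) @^-1` [set n] =
  if @pickle_inv int n is Some z then cell eps s z else set0.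
Proof.
move=> e0; apply/seteqP; split=> w /=.
  by move=> <-; rewrite pickleK_inv cellE.
have := @pickle_invK int n; case: pickle_inv => //= z <-.
by rewrite cellE//= => ->.
Qed.

Let small_stepE (eps s t : R) (z : int) : 0 < eps ->
  small_step eps s t `&` cell eps s z =
  cell eps s z `&` X t @^-1` cell_window eps z.
Proof.
move=> e0; rewrite cellE//; apply/seteqP.
by split=> w; rewrite /small_step/= => -[h1 h2]; split=> //;
  move: h1 h2; [move=> + <-|move=> ->].
Qed.

Lemma filtration_small_step (eps s t : R) : 0 < eps -> 0 <= s -> s <= t ->
  F t (small_step eps s t).
Proof.
move=> e0 s0 st; have t0 := le_trans s0 st.
have [sF _] := hF.1 _ t0; have [F0 _ FU] := sF.
have -> : small_step eps s t = \bigcup_n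
    (if @pickle_inv int n is Some z then
       cell eps s z `&` X t @^-1` cell_window eps z else set0).
  apply/seteqP; split=> [w h|w [n _]].
    have := pickleK_inv (Num.floor (X s w / eps)).
    move: (pickle _) => n nE; exists n => //.
    by rewrite nE -small_stepE// cellE.
  by case: pickle_inv => // z; rewrite -small_stepE// => -[].
apply: FU => n; case: pickle_inv => // z.
apply: sigma_algebra_setI => //; last first.
  by apply: hX => //; exact: measurable_itv.
by apply: (hF.2 _ _ s0 st); exact: F_cell.
Qed.

(** On each cell of [X s] the window is a fixed set, so the Markov property applies on the [F s]
    event [A] cut by that cell. The kernel bound is integrated there, and the cells are summed. *)
Lemma small_step_le (eps dlt s t : R) (A : set T) :
  0 < eps -> 0 <= dlt -> dlt <= 1 -> 0 <= s -> s < t -> F s A ->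
  (forall x z, (dlt%:E <= p s t x (~` cell_window eps z))%E) ->
  (P (A `&` small_step eps s t) <= (1 - dlt)%:E * P A)%E.
Proof.
move=> e0 dlt0 dlt1 s0 st FA hdlt; have t0 := le_trans s0 (ltW st).
have [sF Fm] := hF.1 _ s0; have [_ Fmt] := hF.1 _ t0.
have mA := Fm _ FA.
have mE : measurable (small_step eps s t).
  by apply: Fmt; apply: filtration_small_step => //; exact: ltW.
have mcell z : measurable (cell eps s z) by apply: (Fm); apply: F_cell.
have mfib n : measurable
    ((fun w => pickle (Num.floor (X s w / eps))) @^-1` [set n]).
  by rewrite fiberE//; case: pickle_inv.
apply: (@measure_le_fibers _ _ _ P A (small_step eps s t)
  (fun w => pickle (Num.floor (X s w / eps)))).
- by rewrite subr_ge0.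
- by move=> n; exact: measurableI.
- by move=> n; apply: measurableI => //; exact: measurableI.
move=> n; rewrite fiberE//; case: pickle_inv => [z|]; last first.
  by rewrite !setI0 measure0 mule0.
rewrite -setIA small_stepE// setIA.
set Az := A `&` cell eps s z; set B := X t @^-1` _.
have FAz : F s Az by apply: sigma_algebra_setI => //; exact: F_cell.
have mAz := Fm _ FAz.
have mB : measurable B by apply: Fmt; apply: hX => //; exact: measurable_itv.
have mW : measurable (~` cell_window eps z).
  by apply: measurableC; exact: measurable_itv.
have [_ iY _ /(_ _ FAz)] := hp _ _ s0 st _ mW.
rewrite integral_indic//; last first.
  by rewrite preimage_setC; exact: measurableC.
rewrite preimage_setC -/B => condE.
have esc : (dlt%:E * P Az <= P (~` B `&` Az))%E.
  rewrite -condE -integral_cst//; apply: ge0_le_integral => //.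
    (* Measurability of the kernel along [X s] comes from the integrability clause of
       [is_condexp]. *)
    by apply: measurable_funTS; exact: measurable_int iY.
  by move=> w _; exact: hdlt.
exact: probability_setI_le.
Qed.

End one_step.

(** Uniform continuity by compactness: near each [u], both [v] and [v + n.+1%:R^-1] eventually lie
    in a ball on which [g] varies from [g u] by at most [eps / 2]. *)
Lemma increments_small {R : realType} (g : R -> R) (eps : R) : continuous g ->
  0 < eps -> \forall n \near \oo, forall u, 0 <= u -> u <= 1 ->
    `|g (u + n.+1%:R^-1) - g u| <= eps.
Proof.
move=> cg e0; have e20 : 0 < eps / 2 by rewrite divr_gt0.
have := (compact_near_coveringP _).1 (@segment_compact R 0 1).
move=> /(_ nat \oo (fun n u => `|g (u + n.+1%:R^-1) - g u| <= eps) _) cover.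
suff [N _ hN] : \forall n \near \oo, `[0, 1]%classic `<=`
    (fun u => `|g (u + n.+1%:R^-1) - g u| <= eps).
  exists N => // n /= Nn u u0 u1.
  by apply: hN => //=; rewrite in_itv/= u0.
apply: cover => u _.
have /cvgrPdist_le/(_ _ e20)/nbhs_ballP[r /= r0 hr] := cg u.
have r20 : 0 < r / 2 by rewrite divr_gt0.
near=> v n.
have vr : ball u (r / 2) v by near: v; exact: nbhsx_ballx.
have nr : n.+1%:R^-1 < r / 2.
  by near: n; exact: (near_infty_natSinv_lt (PosNum r20)).
have n0 : 0 < n.+1%:R^-1 :> R by rewrite invr_gt0.
have h1 : `|g u - g v| <= eps / 2.
  by apply: hr; apply: le_ball vr; rewrite ler_pdivrMr// ler_peMr ?ltW// ltr1n.
have h2 : `|g u - g (v + n.+1%:R^-1)| <= eps / 2.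
  apply: hr; move: vr nr n0; move: (n.+1%:R^-1) => l.
  rewrite /ball/= !ltr_norml => /andP[h3 h4] ? ?.
  by apply/andP; split; lra.
rewrite -[_ - _](subrKA (g u)) [leRHS]splitr (le_trans (ler_normD _ _))//.
by rewrite lerD// distrC.
Unshelve. all: by end_near.
Qed.

(** * Iteration of the one-step bound along a time grid *)

Section grid.
Context {R : realType} {d : measure_display} {T : measurableType d}.
Variables (P : probability T R) (F : R -> set (set T)) (X : R -> T -> R).
Variable p : R -> R -> R -> set R -> \bar R.
Hypotheses (hF : filtration F) (hX : adapted F X) (hp : markov_with P F p X).
Variables (eps dlt : R) (tau : nat -> R).
Hypotheses (eps0 : 0 < eps) (dlt0 : 0 <= dlt) (dlt1 : dlt <= 1).
Hypotheses (tau0 : forall k, 0 <= tau k) (tauS : forall k, tau k < tau k.+1).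
Hypothesis escape : forall k x z,
  (dlt%:E <= p (tau k) (tau k.+1) x (~` cell_window eps z))%E.

Fixpoint small_steps (n : nat) : set T :=
  if n is k.+1 then small_steps k `&` small_step X eps (tau k) (tau k.+1)
  else setT.

Lemma filtration_small_steps n : F (tau n) (small_steps n).
Proof.
elim: n => [|n ih] /=.
  have [[F0 FC _] _] := hF.1 _ (tau0 0).
  by rewrite -(setD0 setT); exact: FC.
have [sF _] := hF.1 _ (tau0 n.+1).
apply: sigma_algebra_setI => //.
  exact: (hF.2 _ _ (tau0 n) (ltW (tauS n))).
by apply: (filtration_small_step F X hF hX) => //; exact: ltW.
Qed.

(** The first [n] steps form an event of [F (tau n)], so the next step costs a further factor
    [1 - dlt]. *)
Lemma small_steps_le n : (P (small_steps n) <= ((1 - dlt) ^+ n)%:E)%E.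
Proof.
elim: n => [|n ih] /=; first by rewrite probability_setT.
apply: (le_trans (small_step_le P F X p hF hX hp _ _ _ _ _ eps0 dlt0 dlt1
  (tau0 n) (tauS n) (filtration_small_steps n) (escape n))).
by rewrite exprS EFinM lee_wpmul2l// lee_fin subr_ge0.
Qed.

Lemma small_stepsP n w :
  (forall k, (k < n)%N -> `|X (tau k.+1) w - X (tau k) w| <= eps) ->
  small_steps n w.
Proof.
elim: n => [//|n ih] h /=; split; last by apply: small_stepP => //; exact: h.
by apply: ih => k kn; apply: h; exact: ltnW.
Qed.

End grid.

(** The tail intersections [B m] increase to an event of probability 1, and each lies in some [A n]
    of probability at most [c]. *)
Lemma liminf_probability_le {d : measure_display} {T : measurableType d}
    {R : realType} (P : probability T R) (A : nat -> set T) (c : \bar R) :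
  (forall n, measurable (A n)) -> (\forall n \near \oo, (P (A n) <= c)%E) ->
  {ae P, forall w, \forall n \near \oo, A n w} -> (1 <= c)%E.
Proof.
move=> mA [N0 _ hN0] [N [mN PN0 hN]].
pose B m := \bigcap_(n in [set n | (m <= n)%N]) A n.
have mB m : measurable (B m) by apply: bigcap_measurableType.
have mUB : measurable (\bigcup_m B m) by exact: bigcup_measurable.
have ndB : {homo B : n m / (n <= m)%N >-> (n <= m)%O}.
  move=> i j ij; apply/subsetPset => w Bw n /= jn.
  by apply: Bw => /=; exact: leq_trans jn.
have le_c : (P (\bigcup_m B m) <= c)%E.
  apply: (cvge_to_le (nondecreasing_cvg_mu (mu := P) mB mUB ndB)).
  apply: nearW => m /=; apply: (le_trans _ (hN0 (maxn m N0) _)).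
    apply: le_measure; rewrite ?inE//.
    by move=> w Bw; apply: Bw => /=; exact: leq_maxl.
  by rewrite /=; exact: leq_maxr.
have PUC : P (~` \bigcup_m B m) = 0%E.
  apply/eqP; rewrite eq_le measure_ge0 andbT -PN0.
  apply: le_measure; rewrite ?inE//.
  exact: measurableC.
apply: le_trans le_c; rewrite -(setCK (\bigcup_m B m)).
by rewrite probability_setC ?PUC ?sube0//; exact: measurableC.
Qed.

(** * Contradiction along geometric time grids *)

Theorem theorem7 (R : realType)
    (G : R -> probability R R) (psi : R -> R)
    (hG : log_convolution_semigroup G)
    (hpsi : has_Laplace_exponent G psi)
    (hpsi_half : psi (2^-1) = 1)
    (d : measure_display) (T : measurableType d) (P : probability T R)
    (F : R -> set (set T)) (X : R -> T -> R)
    (hF : filtration F) (hX : adapted F X)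
    (hX0 : {ae P, forall w, X 0 w = 0})
    (hmart : martingale P F X)
    (hmarkov : markov_with P F (transition G) X)
    (hnondeg : ~ degenerate G) :
  ~ continuous_process P X.
Proof.
move=> hcont.
have [q [c [l0 [q0 q1 c0 l00 mass]]]] :=
  jump_mass_ge G psi hG hpsi hpsi_half hnondeg.
have q20 : 0 <= q ^+ 2 by rewrite sqr_ge0.
have q21 : q ^+ 2 < 1 by rewrite expr_lt1.
set K := normal_peak (Num.sqrt (1 - q ^+ 2)).
have K0 : 0 < K by rewrite normal_peak_gt0// gt_eqF// sqrtr_gt0 subr_gt0.
(* A window has length [3 * eps], so its mass bound [K * (3 * eps)] is exactly one half. *)
pose eps := (6 * K)^-1.
have eps0 : 0 < eps by rewrite invr_gt0 mulr_gt0.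
(* Consecutive times have ratio [expR (2 / n.+1%:R)], so the kernel uses [sigma = expR l] with
   [l = n.+1%:R^-1]. All times are at least 1, as the variance bound requires. *)
pose tau n k : R := expR (2 * (k%:R / n.+1%:R)).
have tau_ge1 n k : 1 <= tau n k.
  by rewrite -expR0 ler_expR mulr_ge0// divr_ge0.
have tau_ge0 n k : 0 <= tau n k by exact: expR_ge0.
have tauS n k : tau n k < tau n k.+1.
  by rewrite ltr_expR ltr_pM2l// ltr_pM2r ?invr_gt0// ltr_nat.
have sqrt_ratio n k : Num.sqrt (tau n k.+1 / tau n k) = expR (n.+1%:R^-1).
  rewrite /tau -expRN -expRD.
  have -> : 2 * (k.+1%:R / n.+1%:R) - 2 * (k%:R / n.+1%:R) =
      n.+1%:R^-1 + n.+1%:R^-1 :> R by rewrite -natr1; field.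
  by rewrite expRD -expr2 sqrtr_sqr ger0_norm ?expR_ge0.
pose A n := small_steps X eps (tau n) n.+1.
have mA n : measurable (A n).
  apply: (hF.1 _ (tau_ge0 n n.+1)).2.
  exact: filtration_small_steps.
have : (1 <= (expR (- (c / 2)))%:E :> \bar R)%E; last first.
  rewrite lee_fin -[X in X <= _]expR0 ler_expR; lra.
apply: (liminf_probability_le P A) => //.
  (* The bound [l0] validates the mass estimate, and [c^-1] ensures [dlt <= 1]. *)
  have m0 : 0 < Num.min l0 c^-1 by rewrite lt_min l00 invr_gt0.
  near=> n.
  have : n.+1%:R^-1 < Num.min l0 c^-1.
    by near: n; exact: (near_infty_natSinv_lt (PosNum m0)).
  rewrite lt_min => /andP[nl0 nc].
  have n0 : 0 < n.+1%:R^-1 :> R by rewrite invr_gt0.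
  pose dlt := c / 2 * n.+1%:R^-1.
  have dlt0 : 0 <= dlt by rewrite mulr_ge0 ?divr_ge0 ?ltW.
  have dlt1 : dlt <= 1.
    have : c * n.+1%:R^-1 <= 1 by rewrite mulrC -ler_pdivlMr// div1r ltW.
    move=> /le_trans; rewrite /dlt mulrAC ler_pdivrMr// mul1r; apply.
    by rewrite ler1n.
  have escape k x z : (dlt%:E <=
      transition G (tau n k) (tau n k.+1) x (~` cell_window eps z))%E.
    apply: (le_trans _ (transition_compl_itv_ge G (q ^+ 2) (tau n k)
      (tau n k.+1) x _ _ q20 q21 (expR_gt0 _) (tau_ge1 _ _) _ _)).
    - rewrite sqrt_ratio -[X in (_ <= _ * X)%E]fineK ?fin_num_measure//.
      rewrite -EFinM lee_fin /dlt mulrAC mulrC ler_pM2l//.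
      exact: mass (ltW nl0).
    - by rewrite ler_pM2r//; lra.
    - rewrite -mulrBl -/K /eps.
      suff -> : K * ((z%:~R + 2 - (z%:~R - 1)) * (6 * K)^-1) = 2^-1 by [].
      by field; rewrite gt_eqF.
  apply: (le_trans (small_steps_le P F X _ hF hX hmarkov eps dlt (tau n) eps0
    dlt0 dlt1 (tau_ge0 n) (tauS n) escape n.+1)).
  rewrite lee_fin.
  (* Since [1 - dlt <= expR (- dlt)], the power [n.+1] yields a bound free of [n]. *)
  have -> : - (c / 2) = n.+1%:R * - dlt.
    by rewrite /dlt; field.
  rewrite expRM_natl lerXn2r ?nnegrE ?subr_ge0 ?expR_ge0//.
  exact: expR_ge1Dx.
apply: filterS hcont => w /continuous_within_itvcyP[cw _].
(* In logarithmic time the grid is uniform with mesh [n.+1%:R^-1], and only positive times occur,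
   where the path is continuous on both sides. *)
have cg : continuous (fun u : R => X (expR (2 * u)) w).
  move=> u.
  have ce : {for u, continuous (fun v : R => expR (2 * v))}.
    apply: (@cvg_comp _ _ _ ( *%R 2) expR); last exact: continuous_expR.
    exact: mulrl_continuous.
  have cX : {for expR (2 * u), continuous (X ^~ w)}.
    by apply: cw; rewrite in_itv/= expR_gt0.
  exact: (continuous_comp ce cX).
apply: filterS (increments_small _ _ cg eps0) => n hn.
apply: small_stepsP => // k kn.
have := hn (k%:R / n.+1%:R); rewrite divr_ge0// ler_pdivrMr// mul1r ler_nat.
rewrite (ltnW kn) => /(_ isT isT).
by rewrite -[X in k%:R / _ + X]mul1r -mulrDl natr1.
Unshelve. all: by end_near.
Qed.
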